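(* Let $D$ be a finite group, consider $\Z\wr D$ with generating set $S_D=\{t\}\cup\{\delta_i : i\in D\setminus\{\mathrm{Id}_D\}\}$, and for $n\ge 1$ let $F_n=\{(k,f): k\in\{1,\dots,n\},\ \mathrm{supp}(f)\subset\{1,\dots,n\}\}$. (1) For every $n\geq 2(|D|-1)$ and every finite nonempty $F\subset\Z\wr D$ with $|F|\leq|F_n|$, $$\frac{|\partial_{edge}F|}{|F|}\geq\frac{|\partial_{out}F|}{|F|}\geq\frac{|\partial_{out}F_n|}{|F_n|}=\frac{|\partial_{edge}F_n|}{|F_n|},$$ and if $|F|<|F_n|$ then $\frac{|\partial_{out}F|}{|F|}>\frac{|\partial_{out}F_n|}{|F_n|}$. (2) For every $n\geq 2(|D|-1)$ and every finite nonempty $F\subset\Z\wr D$ with $|F|\leq|F_n\cup\partial_{out}F_n|$, $$\frac{|\partial_{in}F|}{|F|}\geq\frac{|\partial_{in}(F_n\cup\partial_{out}F_n)|}{|F_n\cup\partial_{out}F_n|},$$ and the inequality is strict if $|F|<|F_n\cup\partial_{out}F_n|$. (Note $F_n\cup\partial_{out}F_n=\{(k,f):k\in\{0,\dots,n+1\},\ \mathrm{supp}(f)\subset\{1,\dots,n\}\}$.) Furthermore, the sets attaining equality in (1) (for the outer boundary), respectively in (2), are unique up to translation: they are left translates $gF_n$, respectively $g(F_n\cup\partial_{out}F_n)$, $g\in\Z\wr D$.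
   Context: $\Z\wr D$ is the set of pairs $(k,f)$, $k\in\Z$, $f:\Z\to D$ finitely supported ($\mathrm{supp}(f)=\{x:f(x)\neq\mathrm{Id}_D\}$), with product $(a,f)(a',f')=(a+a',x\mapsto f(x)f'(x-a))$. $t=(1,\mathbb{1})$ with $\mathbb{1}\equiv\mathrm{Id}_D$; $\delta_i=(0,\delta_0^i)$ with $\delta_0^i(0)=i$ and $\delta_0^i(x)=\mathrm{Id}_D$ for $x\neq0$. For a group $G$ with finite generating set $S$ and finite $F\subset G$: the inner boundary is $\partial_{in}F=\{g\in F:\exists s\in S\cup S^{-1}, gs\notin F\}$; the outer boundary is $\partial_{out}F=\{gs: g\in F, s\in S\cup S^{-1}\}\setminus F$ (vertices at distance exactly $1$ from $F$ in the Cayley graph); the edge boundary $\partial_{edge}F$ is the set of edges of the Cayley graph (vertices $G$, $g$ adjacent to $gs$ for $s\in S\cup S^{-1}$) joining a vertex of $F$ to a vertex outside $F$. *)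

(* Defs.v *)
From HB Require Import structures.
From mathcomp Require Import all_boot all_order all_algebra all_fingroup.
From mathcomp Require Import finmap.
Set Implicit Arguments. Unset Strict Implicit. Unset Printing Implicit Defensive.
Import Order.TTheory GRing.Theory Num.Theory.
Local Open Scope fset_scope.

Notation wr gT := (int * {fsfun int -> gT with 1%g})%type.

Section Wreath.
Variable gT : finGroupType.

Definition wmul (g h : wr gT) : wr gT :=
  ((g.1 + h.1)%R,
   [fsfun x in finsupp g.2 `|` [fset (y + g.1)%R | y in finsupp h.2]
      => (g.2 x * h.2 (x - g.1)%R)%g | 1%g]).

Definition winv (g : wr gT) : wr gT :=
  ((- g.1)%R,
   [fsfun x in [fset (y - g.1)%R | y in finsupp g.2] => ((g.2 (x + g.1)%R)^-1)%g | 1%g]).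

Definition wt : wr gT := (1%R, [fsfun x in (fset0 : {fset int}) => 1%g | 1%g]).

Definition wdelta (i : gT) : wr gT := (0%R, [fsfun x in [fset (0%R : int)] => i | 1%g]).

Definition gensD : seq (wr gT) := wt :: [seq wdelta i | i <- enum gT & i != 1%g].

Definition symgensD : seq (wr gT) := gensD ++ map winv gensD.

Definition nbrs (g : wr gT) : seq (wr gT) := [seq wmul g s | s <- symgensD].

Definition bd_in (F : {fset wr gT}) : {fset wr gT} :=
  [fset g in F | has (fun h => h \notin F) (nbrs g)].

Definition bd_out (F : {fset wr gT}) : {fset wr gT} :=
  (\bigcup_(g <- F) [fset h | h in nbrs g]) `\` F.

Definition bd_edge (F : {fset wr gT}) : {fset {fset wr gT}} :=
  \bigcup_(g <- F) [fset [fset g; h] | h in [seq h <- nbrs g | h \notin F]].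

Definition ltrans (g : wr gT) (F : {fset wr gT}) : {fset wr gT} :=
  [fset wmul g x | x in F].

Definition in_Fn (n : nat) (x : wr gT) : Prop :=
  ((1 <= x.1)%R /\ (x.1 <= n%:Z)%R) /\
  (forall y : int, y \in finsupp x.2 -> (1 <= y)%R /\ (y <= n%:Z)%R).

End Wreath.

Definition qratio (a b : nat) : rat := (a%:R / b%:R)%R.

(* Main.v *)
Require Import Defs.
From HB Require Import structures.
From mathcomp Require Import all_boot all_order all_algebra all_fingroup.
From mathcomp Require Import finmap zify ring.
Import Order.TTheory GRing.Theory Num.Theory.
Local Open Scope fset_scope.
Set Implicit Arguments. Unset Strict Implicit. Unset Printing Implicit Defensive.

(** Let q = |D| and let A be the set of lamp configurations occurring in F. Each
    f in A contributes at least two outer boundary points, at the two ends of its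
    line {(k, f)}. A point (k, f) of F whose k-th clique (all values of the lamp at
    k) is not contained in A has a boundary neighbour with a configuration outside
    A, and each such neighbour serves at most q - 1 <= n / 2 points of F. The other
    points of F are counted by the full cliques of A, and the edge-isoperimetric
    inequality in the Hamming graph bounds their number by |A| log_q |A|, with
    equality only for subcubes. So if |A| <= q^n then 2 |F| <= n |bd_out F|, and
    otherwise |bd_out F| > 2 q^n. In the equality case F = K x (cube on K) with
    |K| = n, and a gap in K would give a third boundary point on every line.
    The inner boundary reduces to the outer one, because the outer boundary of
    F `\` bd_in F is contained in bd_in F. *)

(** * Chords of the function (q - 1) a log_q a *)

(** The affine function of [a] that agrees with (q - 1) a log_q a at [q ^ e] and at [q ^ e.+1]. *)
Definition chord (q e a : nat) : int :=
  (((q - 1) * e + q)%N%:Z * a%:Z - (q ^ e.+1)%N%:Z)%R.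

(** The piecewise linear interpolation of (q - 1) a log_q a at the powers of q:
    an integer-valued substitute for the logarithm which is still exact at q^n. *)
Definition psi (q a : nat) : int := chord q (trunc_log q a) a.

Lemma chordS q e a : (0 < q)%N ->
  (chord q e.+1 a = chord q e a + (q - 1)%N%:Z * (a%:Z - (q ^ e.+1)%N%:Z))%R.
Proof.
move=> q0; rewrite /chord (expnS q e.+1); set Q := (q ^ e.+1)%N.
have -> : ((q - 1) * e.+1 + q)%N = (((q - 1) * e + q) + (q - 1))%N by lia.
by rewrite PoszD (PoszM q) (_ : q%:Z = (q - 1)%N%:Z + 1)%R; [ring | lia].
Qed.

(** By convexity [psi] is the maximum of its chords. The chords [e] and [e.+1] cross at [q ^ e.+1],
    so moving the exponent stepwise towards [trunc_log q a] never decreases the value at [a]. *)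
Lemma chord_le_psi q e a : (1 < q)%N -> (0 < a)%N -> (chord q e a <= psi q a)%R.
Proof.
move=> q1 a0; rewrite /psi; set t := trunc_log q a.
have q0 : (0 < q)%N by lia.
have [lo hi] : (q ^ t <= a)%N /\ (a < q ^ t.+1)%N.
  by apply/andP; exact: trunc_log_bounds.
case: (leqP e t) => [let_|ltt].
  have -> : e = (t - (t - e))%N by lia.
  elim: (t - e)%N => [|d IH]; first by rewrite subn0.
  apply: le_trans IH; case: (leqP t d) => dt.
    by rewrite (_ : t - d.+1 = t - d)%N //; lia.
  rewrite (_ : t - d = (t - d.+1).+1)%N; last lia.
  rewrite chordS // lerDl; apply: mulr_ge0 => //.
  have : (q ^ (t - d.+1).+1 <= q ^ t)%N by rewrite leq_pexp2l //; lia.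
  lia.
have -> : e = (t + (e - t))%N by lia.
elim: (e - t)%N => [|d IH]; first by rewrite addn0.
apply: le_trans IH; rewrite addnS chordS // gerDl.
have : (q ^ t.+1 <= q ^ (t + d).+1)%N by rewrite leq_pexp2l //; lia.
move=> h; rewrite mulr_ge0_le0 //; lia.
Qed.

Lemma psi_le q n a : (1 < q)%N -> (0 < a)%N -> (a <= q ^ n)%N ->
  (psi q a <= ((q - 1) * (n * a))%N%:Z)%R.
Proof.
move=> q1 a0 an; rewrite /psi; set t := trunc_log q a.
have [lo hi] : (q ^ t <= a)%N /\ (a < q ^ t.+1)%N.
  by apply/andP; exact: trunc_log_bounds.
have q0 : (0 < q)%N by lia.
have tn : (t <= n)%N by rewrite -(leq_exp2l _ _ q1) (leq_trans lo).
rewrite /chord expnS.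
case: (ltnP t n) => [ltn|let_].
  have h1 : (a <= q * q ^ t)%N by rewrite -expnS ltnW.
  have h2 : ((q - 1) * (t.+1 * a) <= (q - 1) * (n * a))%N.
    by rewrite leq_pmul2l ?leq_pmul2r //; lia.
  nia.
have et : t = n by lia.
have ea : a = (q ^ t)%N by apply/eqP; rewrite eqn_leq lo et an.
rewrite -ea et; nia.
Qed.

Lemma psi_exp q n : (1 < q)%N -> (psi q (q ^ n) = ((q - 1) * (n * q ^ n))%N%:Z)%R.
Proof.
move=> q1; rewrite /psi trunc_expnK // /chord expnS; nia.
Qed.

(** The chord of exponent 0 is q (a - 1). It bounds [psi] from below, here and in the next lemma. *)
Lemma psi_ge0 q a : (1 < q)%N -> (0 < a)%N -> (0 <= psi q a)%R.
Proof.
move=> q1 a0; apply: le_trans (chord_le_psi 0 q1 a0).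
rewrite /chord expn1; nia.
Qed.

Lemma psi_eq0 q a : (1 < q)%N -> (0 < a)%N -> (psi q a = 0)%R -> a = 1%N.
Proof.
move=> q1 a0 h; have := chord_le_psi 0 q1 a0.
rewrite h /chord expn1; nia.
Qed.

(** The induction step of the isoperimetric inequality: a i are the sizes of the
    slices of A in one direction and m is the number of full cliques. *)
Lemma psi_sum (I : finType) (a : I -> nat) (m : nat) : (1 < #|I|)%N ->
  (forall i, 0 < a i)%N -> (forall i, m <= a i)%N ->
  (\sum_i psi #|I| (a i) + ((#|I| - 1) * (#|I| * m))%N%:Z
     <= psi #|I| (\sum_i a i)%N)%R /\
  ((\sum_i psi #|I| (a i) + ((#|I| - 1) * (#|I| * m))%N%:Z
     = psi #|I| (\sum_i a i)%N)%R -> forall i, a i = m).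
Proof.
set q := #|I| => q1 a0 ma; have q0 : (0 < q)%N by lia.
pose e i := trunc_log q (a i).
have bd i : (q ^ e i <= a i)%N /\ (a i < q ^ (e i).+1)%N.
  by apply/andP; exact: trunc_log_bounds.
have [i0 _] : exists i0 : I, true by move: q0; rewrite /q; case/card_gt0P=> i; exists i.
pose j := [arg max_(i > i0) e i]; pose M := e j.
have eM i : (e i <= M)%N by rewrite /M /j; case: arg_maxnP => // k _; apply.
have S0 : (0 < \sum_i a i)%N by rewrite (bigD1 i0) //= ltn_addr.
have sumE (F : I -> nat) : ((\sum_i F i)%N%:Z = \sum_i (F i)%:Z)%R.
  exact: (big_morph Posz PoszD erefl).
(* If all the a i lie between the same two powers of q, the sum is compared with the
   next chord; otherwise the chord of the largest a i gives a strict inequality. *)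
case: (boolP [forall i, e i == M]) => [/forallP allM|].
  (* The [q] constants [q ^ M.+1] add up to [q ^ M.+2], the constant of the next chord. *)
  have Es : (\sum_i psi q (a i) = chord q M.+1 (\sum_i a i)
             - (q - 1)%N%:Z * (\sum_i a i)%N%:Z)%R.
    rewrite (eq_bigr (fun i => ((q - 1) * M + q)%N%:Z * (a i)%:Z
                               - (q ^ M.+1)%N%:Z)%R); last first.
      by move=> i _; rewrite /psi -/(e i) (eqP (allM i)).
    rewrite sumrB -mulr_sumr -sumE sumr_const -/q /chord (expnS q M.+1).
    rewrite -mulr_natl natz PoszM.
    have -> : ((q - 1) * M.+1 + q)%N = (((q - 1) * M + q) + (q - 1))%N by lia.
    rewrite PoszD; ring.
  (* The slack against the next chord is [q - 1] times the sum of the [a i - m], so equality makes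
     each of these zero. *)
  have Em : (q * m + \sum_i (a i - m) = \sum_i a i)%N.
    rewrite -sum_nat_const -big_split /=; apply: eq_bigr => i _.
    by rewrite subnKC.
  have h := chord_le_psi M.+1 q1 S0.
  rewrite Es; split; first by move: h Em; nia.
  move=> hE; have /eqP : (\sum_i (a i - m) = 0)%N by move: h Em hE; nia.
  rewrite sum_nat_eq0 => /forallP z i; have := z i; have := ma i; lia.
rewrite negb_forall => /existsP [i1 hi1].
have i1j : i1 != j by apply: contraNneq hi1 => ->.
(* If [e i = M], the constant [q ^ M.+1] suffices because [m <= a i1 < q ^ M]. If [e i < M], the
   smaller slope saves [(q - 1) * a i] and the constant saves more than [a i]. *)
have tm i : (psi q (a i) + ((q * m)%N%:Z + 1) <= ((q - 1) * M + q)%N%:Z * (a i)%:Z)%R.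
  rewrite /psi -/(e i) /chord expnS; have [b1 b2] := bd i.
  have := eM i; rewrite leq_eqVlt => /orP [/eqP ei|lt].
    have [c1 c2] := bd i1.
    have : (q ^ (e i1).+1 <= q ^ M)%N.
      by rewrite leq_pexp2l // ltn_neqAle hi1 eM.
    move=> c3; have : (q * m.+1 <= q * q ^ M)%N by rewrite leq_mul2l (leq_ltn_trans (ma i1)) ?orbT // (leq_trans c2).
    rewrite mulnS ei => c4; rewrite -addrA gerDl addrC subr_le0 -PoszD lez_nat (leq_trans _ c4) // addnC leq_add2r; exact: q0.
  have : ((q - 1) * (e i).+1 * a i <= (q - 1) * M * a i)%N.
    by rewrite leq_mul2r leq_mul2l lt !orbT.
  move=> c3; have c4 : (q * m + 1 <= q * q ^ e i + (q - 1) * a i)%N.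
    have : (q * a i <= (q - 1) * a i + a i)%N by rewrite -{3}(mul1n (a i)) -mulnDl subnK.
    have : (q * m <= q * a i)%N by rewrite leq_mul2l ma orbT.
    by move: b2; rewrite expnS; lia.
  have c5 : ((q - 1) * (e i).+1 * a i = (q - 1) * e i * a i + (q - 1) * a i)%N by lia.
  have hX : ((q - 1) * e i + q)%N * a i + (q - 1) * a i <= ((q - 1) * M + q)%N * a i.
    by rewrite !mulnDl -addnA [(q * a i + _)%N]addnC addnA leq_add2r -c5.
  move: hX c4; rewrite -!PoszM; lia.
have hj : (psi q (a j) = ((q - 1) * M + q)%N%:Z * (a j)%:Z - (q ^ M.+1)%N%:Z)%R by [].
(* The term [j] uses up the constant of the chord [M]. The [q - 1] others gain [q * m + 1] each,
   which exceeds what is required. *)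
have hlt : (\sum_i psi q (a i) + ((q - 1) * (q * m))%N%:Z
     < psi q (\sum_i a i)%N)%R.
  apply: lt_le_trans (chord_le_psi M q1 S0).
  rewrite /chord sumE mulr_sumr (bigD1 j) //= [X in (_ < X - _)%R](bigD1 j) //= hj.
  have hs : (\sum_(i | i != j) psi q (a i) + ((q - 1) * (q * m + 1))%N%:Z
     <= \sum_(i | i != j) ((q - 1) * M + q)%N%:Z * (a i)%:Z)%R.
    have -> : (((q - 1) * (q * m + 1))%N%:Z = \sum_(i | i != j) ((q * m)%N%:Z + 1))%R.
      rewrite sumr_const (_ : #|_| = q - 1)%N; last first.
        have := cardC (pred1 j); rewrite card1 -/q => <-.
        by rewrite addKn; apply: eq_card.
      rewrite -mulr_natl natz; lia.
    by rewrite -big_split /=; apply: ler_sum => i _; exact: tm.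
  move: hs; rewrite mulnDr muln1 PoszD => hs.
  rewrite -addrA addrAC ltrD2r ltrD2l.
  apply: lt_le_trans hs; rewrite ltrD2l ltrDl; lia.
by split; [exact: ltW | move=> E; rewrite E ltxx in hlt].
Qed.

(** * Counting in finite sets *)

Section FiniteSets.
Variables (T T' : choiceType).
Implicit Types (A : {fset T}) (B : {fset T'}).

Lemma card_le_inj A B (f : T -> T') :
  {in A, forall x, f x \in B} -> {in A &, injective f} -> (#|` A| <= #|` B|)%N.
Proof.
move=> fB fI; rewrite -(card_in_imfset imfset_key fI).
by apply/fsubset_leq_card/fsubsetP=> y /imfsetP [x /= xA ->]; exact: fB.
Qed.

Lemma in_sep A (P : pred T) x : (x \in [fset y in A | P y]) = (x \in A) && P x.
Proof. by rewrite !inE. Qed.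

Lemma card_inj_fset A (f : T -> T') : injective f ->
  #|` [fset f x | x in A]| = #|` A|.
Proof. by move=> fI; exact: card_imfset. Qed.

Lemma card_image_le A (f : T -> T') : (#|` [fset f x | x in A]| <= #|` A|)%N.
Proof. exact: leq_imfset_card. Qed.

Lemma card_fsetM A B : #|` A `*` B| = (#|` A| * #|` B|)%N.
Proof.
have h : {in A & B, forall x y, True} by [].
rewrite -[RHS](size_allpairs (fun x y => (x, y))).
rewrite -[RHS]/(size [seq (x, y) | x <- enum_fset A, y <- enum_fset B]).
apply: perm_size; apply: uniq_perm; first exact: fset_uniq.
  by apply: allpairs_uniq => // -[x y] [x' y'].
move=> [x y]; rewrite in_fsetM /=; apply/andP/allpairsP => [[xA yB]|].
  by exists (x, y).
by case=> -[x' y'] /= [xA yB [-> ->]].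
Qed.

Lemma card_fibers (I : finType) (p : T -> I) A :
  #|` A| = (\sum_i #|` [fset x in A | p x == i]|)%N.
Proof.
rewrite card_fset_sum1 (partition_big p predT) //=.
apply: eq_bigr => i _; rewrite card_fset_sum1 [RHS]big_fset /=.
by apply: congr_big.
Qed.

End FiniteSets.

(** * Full cliques of lamp configurations and the edge-isoperimetric inequality *)

Section Configurations.
Variable gT : finGroupType.
Notation cfg := {fsfun int -> gT with 1%g}.
Implicit Types (A : {fset cfg}) (f : cfg) (k : int) (d : gT).

Definition upd f k d : cfg := [fsfun f with k |-> d].

Lemma updE f k d x : upd f k d x = if x == k then d else f x.
Proof. exact: fsfun_withE. Qed.

Lemma upd_id f k : upd f k (f k) = f.
Proof. exact: fsfun_with_id. Qed.

Lemma upd_upd f k d d' : upd (upd f k d) k d' = upd f k d'.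
Proof. by apply/fsfunP => x; rewrite !updE; case: eqP. Qed.

Lemma upd_inj k d f f' : f k = f' k -> upd f k d = upd f' k d -> f = f'.
Proof.
move=> ek /fsfunP h; apply/fsfunP => x; have := h x; rewrite !updE.
by case: eqP => // ->.
Qed.

Definition full A k f := [forall d, upd f k d \in A].

Definition full_at A k : {fset cfg} := [fset f in A | full A k f].

Definition slice A k d : {fset cfg} := [fset f in A | f k == d].

(** Membership in the subcube through [f0] with free coordinates [K]. *)
Definition agree f0 (K : {fset int}) f := forall x, x \notin K -> f x = f0 x.

Lemma in_full_at A k f : (f \in full_at A k) = full A k f.
Proof.
rewrite !inE /=; apply: andb_idl => /forallP /(_ (f k)).
by rewrite upd_id.
Qed.

Lemma full_upd A k f d : full A k (upd f k d) = full A k f.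
Proof. by apply: eq_forallb => e; rewrite upd_upd. Qed.

Lemma full_slice A k0 k d f : k != k0 ->
  full (slice A k0 d) k f = full A k f && (f k0 == d).
Proof.
rewrite eq_sym => /negPf k0k; apply/forallP/andP => [h|[/forallP h fd] e].
  split; first by apply/forallP => e; have := h e; rewrite !inE => /andP[].
  by have := h 1%g; rewrite !inE updE k0k => /andP[].
by rewrite !inE h updE k0k.
Qed.

Lemma card_full_at_slice A k0 k : k != k0 ->
  #|` full_at A k| = (\sum_d #|` full_at (slice A k0 d) k|)%N.
Proof.
move=> kk0; rewrite (card_fibers (fun f : cfg => f k0)); apply: eq_bigr => d _.
rewrite (_ : [fset f in _ | _] = full_at (slice A k0 d) k) //; apply/fsetP => f.
by rewrite [RHS]in_full_at full_slice // -in_full_at in_sep.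
Qed.

(** Every full clique meets each fibre of the lamp at [k] exactly once, so updating that lamp
    matches the fibres. *)
Lemma card_full_at_fiber A k d d' :
  #|` [fset f in full_at A k | f k == d]| = #|` [fset f in full_at A k | f k == d']|.
Proof.
apply/eqP; rewrite eqn_leq; apply/andP; split.
- apply: (@card_le_inj _ _ _ _ (fun f => upd f k d')).
    move=> f; rewrite in_sep in_full_at => /andP[h _].
    by rewrite in_sep in_full_at full_upd h updE !eqxx.
  move=> f f'; rewrite !in_sep => /andP[_ /eqP h] /andP[_ /eqP h'].
  by apply: upd_inj; rewrite h h'.
- apply: (@card_le_inj _ _ _ _ (fun f => upd f k d)).
    move=> f; rewrite in_sep in_full_at => /andP[h _].
    by rewrite in_sep in_full_at full_upd h updE !eqxx.
  move=> f f'; rewrite !in_sep => /andP[_ /eqP h] /andP[_ /eqP h'].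
  by apply: upd_inj; rewrite h h'.
Qed.

(** Induction on the directions: [A] is cut into slices along [k0], full cliques in the other
    directions split among the slices, and [psi_sum] adds the bounds up. *)
Lemma full_count_le_psi (s : seq int) A : uniq s -> (1 < #|gT|)%N -> A != fset0 ->
  (((#|gT| - 1) * \sum_(k <- s) #|` full_at A k|)%N%:Z <= psi #|gT| #|` A|)%R /\
  ((((#|gT| - 1) * \sum_(k <- s) #|` full_at A k|)%N%:Z = psi #|gT| #|` A|)%R ->
   exists f0 (K : {fset int}), {subset K <= s} /\
     forall f, f \in A <-> agree f0 K f).
Proof.
move=> us q1; elim: s A us => [|k0 s IH] A /=.
  move=> _ A0; rewrite big_nil muln0.
  have c0 : (0 < #|` A|)%N by rewrite cardfs_gt0.
  split; first exact: psi_ge0.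
  move/esym/(psi_eq0 q1 c0)/eqP/cardfs1P => [f0 ->].
  exists f0, fset0; split=> [x|f]; first by rewrite in_fset0.
  rewrite in_fset1; split=> [/eqP -> //|h].
  by apply/eqP/fsfunP => x; apply: h; rewrite inE.
case/andP => k0s us A0; rewrite big_cons.
(* With an empty slice no clique along [k0] is full, so [k0] contributes nothing. *)
case: (boolP [forall d, slice A k0 d != fset0]) => [/forallP sl0|]; last first.
  rewrite negb_forall => /existsP [d]; rewrite negbK => /eqP sl0.
  have -> : full_at A k0 = fset0.
    apply/fsetP => f; rewrite in_full_at inE; apply/negP => /forallP /(_ d) h.
    have : upd f k0 d \in slice A k0 d by rewrite !inE h updE !eqxx.
    by rewrite sl0 inE.
  rewrite cardfs0 add0n; have [h1 h2] := IH A us A0; split=> // /h2.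
  by case=> f0 [K [Ks h]]; exists f0, K; split=> // x /Ks; rewrite inE orbC => ->.
(* Each full clique along [k0] is counted by its point with trivial lamp at [k0]. *)
pose m := #|` [fset f in full_at A k0 | f k0 == 1%g]|.
have Em : #|` full_at A k0| = (#|gT| * m)%N.
  rewrite (card_fibers (fun f : cfg => f k0)) -sum_nat_const.
  by apply: eq_bigr => d _; exact: card_full_at_fiber.
have ma d : (m <= #|` slice A k0 d|)%N.
  rewrite /m (card_full_at_fiber A k0 _ d); apply/fsubset_leq_card/fsubsetP => f.
  by rewrite !inE => /andP[/andP[-> _] ->].
have EA : #|` A| = (\sum_d #|` slice A k0 d|)%N by exact: card_fibers.
have ES : (\sum_(k <- s) #|` full_at A k| =
           \sum_d \sum_(k <- s) #|` full_at (slice A k0 d) k|)%N.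
  rewrite exchange_big /=; rewrite !big_seq; apply: eq_bigr => k ks.
  by apply: card_full_at_slice; apply: contraNneq k0s => <-.
have a0 d : (0 < #|` slice A k0 d|)%N by rewrite cardfs_gt0.
have [hP hPe] := psi_sum q1 a0 ma.
have sumE (F : gT -> nat) : ((\sum_d F d)%N%:Z = \sum_d (F d)%:Z)%R.
  exact: (big_morph Posz PoszD erefl).
set g := fun d => (\sum_(k <- s) #|` full_at (slice A k0 d) k|)%N in ES.
have gle d : (((#|gT| - 1) * g d)%N%:Z <= psi #|gT| #|` slice A k0 d|)%R.
  exact: (IH _ us (sl0 d)).1.
have Eg : (((#|gT| - 1) * \sum_d g d)%N%:Z = \sum_d ((#|gT| - 1) * g d)%N%:Z)%R.
  by rewrite big_distrr sumE.
have gsum : (((#|gT| - 1) * \sum_d g d)%N%:Z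
     <= \sum_d psi #|gT| #|` slice A k0 d|)%R.
  by rewrite Eg; apply: ler_sum => d _; exact: gle.
rewrite ES Em mulnDr PoszD EA; split.
  by apply: le_trans hP; rewrite addrC lerD2r.
move=> E; have E1 : (((#|gT| - 1) * \sum_d g d)%N%:Z
     = \sum_d psi #|gT| #|` slice A k0 d|)%R.
  apply/eqP; rewrite eq_le gsum /=; move: hP; rewrite -E addrC.
  by rewrite lerD2l.
have am d : #|` slice A k0 d| = m.
  by apply: hPe; rewrite -E1 addrC.
have gE d : (((#|gT| - 1) * g d)%N%:Z = psi #|gT| #|` slice A k0 d|)%R.
  apply/eqP; rewrite eq_sym -subr_eq0; apply/eqP.
  apply: (psumr_eq0P (P := predT)
    (F := fun d => psi #|gT| #|` slice A k0 d| - ((#|gT| - 1) * g d)%N%:Z)%R) => //.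
    by move=> i _; rewrite subr_ge0.
  by rewrite sumrB -Eg E1 subrr.
(* Equal slices of size [m] leave room only for full cliques, so the cube found in one slice extends
   freely along [k0]. *)
have Afull : full_at A k0 = A.
  apply/eqP; rewrite eqEfcard; apply/andP; split.
    by apply/fsubsetP => f; rewrite !inE => /andP[].
  by rewrite EA Em -sum_nat_const; apply: eq_leq; apply: eq_bigr.
have [f0 [K [Ks hK]]] := (IH _ us (sl0 1%g)).2 (gE 1%g).
exists f0, (k0 |` K); split.
  by move=> x; rewrite !inE => /orP [-> //|/Ks ->]; rewrite orbT.
move=> f; split=> [fA x|h].
  rewrite !inE negb_or => /andP[xk0 xK].
  have : upd f k0 1%g \in slice A k0 1%g.
    rewrite !inE updE !eqxx andbT.
    by move: fA; rewrite -{1}Afull in_full_at => /forallP.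
  by move/hK/(_ x xK); rewrite updE (negPf xk0).
have : upd f k0 1%g \in slice A k0 1%g.
  apply/hK => x xK; rewrite updE; case: eqP => [ex|/eqP xk0].
    (* When [k0] is outside [K], any element [f1] of the slice shows that [f0] is trivial at
       [k0]. *)
    have /hK h0 : upd f0 k0 1%g \in slice A k0 1%g.
      have [f1 f1s] : exists f1, f1 \in slice A k0 1%g by exact/fset0Pn.
      have e1 : f1 k0 = 1%g by move: f1s; rewrite !inE => /andP[_ /eqP].
      have /hK h1 := f1s.
      apply/hK => y yK; rewrite updE; case: eqP => // ey.
      by rewrite -h1 ?ey // -ey.
    by rewrite -h0 // updE ex eqxx.
  by apply: h; rewrite !inE negb_or xk0.
rewrite !inE => /andP[]; rewrite -{1}Afull in_full_at full_upd => /forallP /(_ (f k0)).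
by rewrite upd_id.
Qed.

End Configurations.

(** * Subcubes and integer intervals *)

Section Cubes.
Variable gT : finGroupType.
Notation cfg := {fsfun int -> gT with 1%g}.

(** Takes the values of [c] on [K] and of [f0] elsewhere; this parametrization gives the cardinality
    of a cube. *)
Definition glue (f0 : cfg) (K : {fset int}) (c : {ffun K -> gT}) : cfg :=
  [fsfun x in finsupp f0 `|` K => oapp c (f0 x) (insub x) | 1%g].

Definition cube (f0 : cfg) (K : {fset int}) : {fset cfg} :=
  [fset glue f0 c | c in {: {ffun K -> gT}}].

Lemma glueE f0 (K : {fset int}) (c : {ffun K -> gT}) x :
  glue f0 c x = oapp c (f0 x) (insub x).
Proof.
rewrite /glue fsfunE; case: ifP => //; rewrite in_fsetU => /negbT.
rewrite negb_or => /andP[/fsfun_dflt h xK].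
by rewrite insubN //= h.
Qed.

Lemma cubeP f0 K (f : cfg) : f \in cube f0 K <-> agree f0 K f.
Proof.
split=> [/imfsetP [c _ ->] x xK|h]; first by rewrite glueE insubN.
apply/imfsetP; exists [ffun k => f (val k)] => //.
apply/fsfunP => x; rewrite glueE; case: insubP => [u _ <-|/h //].
by rewrite /= ffunE.
Qed.

Lemma card_cube f0 K : #|` cube f0 K| = (#|gT| ^ #|` K|)%N.
Proof.
rewrite card_imfset /=; last first.
  move=> c c' /fsfunP h; apply/ffunP => k; have := h (val k).
  by rewrite !glueE valK.
by rewrite -cardE card_ffun -cardfE.
Qed.

End Cubes.

Definition zrange (a : int) (n : nat) : {fset int} :=
  [fset (a + i%:Z)%R | i in iota 0 n].

Lemma in_zrange a n x : (x \in zrange a n) = (a <= x < a + n%:Z)%R.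
Proof.
apply/imfsetP/idP => [[i /=]|h]; first by rewrite mem_iota => h ->; lia.
by exists `|x - a|%N; rewrite /= ?mem_iota; lia.
Qed.

Lemma card_zrange a n : #|` zrange a n| = n.
Proof.
rewrite card_imfset /=; first by rewrite undup_id ?size_iota ?iota_uniq.
by move=> i j /addrI [].
Qed.

(** * The Cayley graph of the wreath product and its boundaries *)

Section WreathGraph.
Variable gT : finGroupType.
Notation cfg := {fsfun int -> gT with 1%g}.
Implicit Types (g h x y : wr gT) (F : {fset wr gT}).

Lemma wr_eq g h : g.1 = h.1 -> g.2 =1 h.2 -> g = h.
Proof. by case: g h => [k f] [k' f'] /= -> /fsfunP ->. Qed.

Lemma wmulE g h z : (wmul g h).2 z = (g.2 z * h.2 (z - g.1)%R)%g.
Proof.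
rewrite /wmul /= fsfunE; case: ifP => // /negbT.
rewrite !inE /= negb_or => /andP[/fsfun_dflt -> hz].
rewrite fsfun_dflt ?mulg1 //; apply: contra hz => hz.
by apply/imfsetP; exists (z - g.1)%R; rewrite //= subrK.
Qed.

Lemma winvE g z : (winv g).2 z = (g.2 (z + g.1)%R)^-1%g.
Proof.
rewrite /winv /= fsfunE; case: ifP => // /negbT hz.
rewrite fsfun_dflt ?invg1 //; apply: contra hz => hz.
by apply/imfsetP; exists (z + g.1)%R; rewrite //= addrK.
Qed.

Lemma wtE z : (wt gT).2 z = 1%g.
Proof. by rewrite /wt /= fsfunE inE. Qed.

Lemma wdeltaE (i : gT) z : (wdelta i).2 z = if z == 0%R then i else 1%g.
Proof. by rewrite /wdelta /= fsfunE inE. Qed.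

Lemma wmul_inj g : injective (wmul g).
Proof.
move=> x y e; apply: wr_eq => [|z].
  by have /(congr1 fst) /= /addrI := e.
have := congr1 (fun u : wr gT => u.2 (z + g.1)%R) e.
by rewrite /= -/(wmul g x).2 -/(wmul g y).2 !wmulE addrK => /mulgI.
Qed.

Lemma wmul_wt g : wmul g (wt gT) = ((g.1 + 1)%R, g.2).
Proof. by apply: wr_eq => // z; rewrite wmulE wtE mulg1. Qed.

Lemma wmul_wtV g : wmul g (winv (wt gT)) = ((g.1 - 1)%R, g.2).
Proof. by apply: wr_eq => // z; rewrite wmulE winvE wtE invg1 mulg1. Qed.

Lemma wmul_wdelta g i : wmul g (wdelta i) = (g.1, upd g.2 g.1 (g.2 g.1 * i)%g).
Proof.
apply: wr_eq => [|z]; first by rewrite /= addr0.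
rewrite wmulE wdeltaE subr_eq0 updE; case: eqP => [->|_] //.
by rewrite mulg1.
Qed.

Lemma wmul_wdeltaV g i :
  wmul g (winv (wdelta i)) = (g.1, upd g.2 g.1 (g.2 g.1 * i^-1)%g).
Proof.
apply: wr_eq => [|z]; first by rewrite /= oppr0 addr0.
rewrite wmulE winvE wdeltaE addr0 subr_eq0 updE; case: eqP => [->|_] //.
by rewrite invg1 mulg1.
Qed.

(** The lamplighter picture: [wt] and its inverse move the position by one, and a [wdelta] changes
    only the lamp at the current position, to any other value. *)
Lemma mem_nbrs g h : h \in nbrs g <->
  (h = ((g.1 + 1)%R, g.2) \/ h = ((g.1 - 1)%R, g.2)) \/
  exists2 d, d != g.2 g.1 & h = (g.1, upd g.2 g.1 d).
Proof.
have mulN1 (d e : gT) : d != e -> (e^-1 * d)%g != 1%g.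
  by move=> de; rewrite -eq_mulVg1 eq_sym.
split=> [/mapP [s]|].
  rewrite mem_cat inE => /orP[/orP[/eqP ->|/mapP [i]]|].
  - by rewrite wmul_wt => ->; left; left.
  - rewrite mem_filter => /andP[i1 _] -> ->; right; exists (g.2 g.1 * i)%g.
      by rewrite -{2}(mulg1 (g.2 g.1)) (inj_eq (mulgI _)).
    exact: wmul_wdelta.
  - case/mapP => s'; rewrite inE => /orP[/eqP -> -> ->|/mapP [i]].
      by rewrite wmul_wtV; left; right.
    rewrite mem_filter => /andP[i1 _] -> -> ->; right; exists (g.2 g.1 * i^-1)%g.
      by rewrite -{2}(mulg1 (g.2 g.1)) (inj_eq (mulgI _)) invg_eq1.
    exact: wmul_wdeltaV.
case=> [[->|->]|[d dg ->]]; apply/mapP.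
- by exists (wt gT); rewrite ?wmul_wt // mem_cat inE eqxx.
- exists (winv (wt gT)); rewrite ?wmul_wtV // mem_cat; apply/orP; right.
  by apply: map_f; rewrite inE eqxx.
- exists (wdelta ((g.2 g.1)^-1 * d)%g); last by rewrite wmul_wdelta mulKVg.
  rewrite mem_cat inE; apply/orP; left; apply/orP; right.
  by apply: map_f; rewrite mem_filter mulN1 // mem_enum.
Qed.

Lemma nbrs_wmul g x y : y \in nbrs x -> wmul g y \in nbrs (wmul g x).
Proof.
move/mem_nbrs => h; apply/mem_nbrs; case: h => [[->|->]|[d dx ->]].
- left; left; apply: wr_eq => [|z]; first by rewrite /= addrA.
  by rewrite wmulE.
- left; right; apply: wr_eq => [|z]; first by rewrite /= addrA.
  by rewrite wmulE.
- right; exists (g.2 (g.1 + x.1)%R * d)%g.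
    by rewrite wmulE /= addrAC subrr add0r (inj_eq (mulgI _)).
  apply: wr_eq => [//|z]; rewrite wmulE /= !updE subr_eq addrC.
  by case: eqP => [->|_] //; rewrite wmulE addrC.
Qed.

Lemma bd_outP F y : reflect (y \notin F /\ exists2 g, g \in F & y \in nbrs g)
  (y \in bd_out F).
Proof.
rewrite in_fsetD; apply: (iffP andP) => -[yF].
  by case/bigfcupP => g /andP[gF _] /imfsetP [h /= hg yh]; split=> //; exists g; rewrite // yh.
case=> g gF yg; split=> //; apply/bigfcupP; exists g; first by rewrite gF.
by apply/imfsetP; exists y.
Qed.

Lemma bd_inP F x : reflect (x \in F /\ exists2 h, h \in nbrs x & h \notin F)
  (x \in bd_in F).
Proof.
rewrite in_sep; apply: (iffP andP) => -[xF].
  by case/hasP => h h1 h2; split=> //; exists h.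
by case=> h h1 h2; split=> //; apply/hasP; exists h.
Qed.

Lemma bd_edgeP F e :
  reflect (exists g h, [/\ g \in F, h \in nbrs g, h \notin F & e = [fset g; h]])
  (e \in bd_edge F).
Proof.
rewrite /bd_edge; apply: (iffP (bigfcupP _ _ _ _)) => [[g /andP[gF _]]|[g [h [gF hg hF ->]]]].
  case/imfsetP => h; change (h \in [seq h0 <- nbrs g | h0 \notin F] -> e = [fset g; h] -> exists g0 h0, [/\ g0 \in F, h0 \in nbrs g0, h0 \notin F & e = [fset g0; h0]]); rewrite mem_filter => /andP[hF hg] ->.
  by exists g, h.
exists g; first by rewrite gF.
by apply/imfsetP; exists h => //; apply: (etrans (mem_filter _ _ _)); rewrite hF.
Qed.

Lemma edge_setD F g h : g \in F -> h \notin F -> [fset g; h] `\` F = [fset h].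
Proof.
move=> gF hF; apply/fsetP => x; rewrite in_fsetD in_fset2 in_fset1.
have [->|_] := eqVneq x g; last by have [->|_] := eqVneq x h; rewrite ?hF ?andbF.
by rewrite gF; apply/esym/negP => /eqP e; rewrite -e gF in hF.
Qed.

(** Removing [F] from a boundary edge leaves its outer endpoint, and every outer boundary point
    arises in this way. *)
Lemma leq_bd_out_edge F : (#|` bd_out F| <= #|` bd_edge F|)%N.
Proof.
rewrite -(card_inj_fset (bd_out F) (@fset1_inj _)).
apply: leq_trans (card_image_le (bd_edge F) (fun e => e `\` F)).
apply/fsubset_leq_card/fsubsetP => e /imfsetP [y /= /bd_outP [yF [g gF yg]] ->].
apply/imfsetP; exists [fset g; y] => /=; last by rewrite edge_setD.
by apply/bd_edgeP; exists g, y.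
Qed.

(** If outer points have a single neighbour in [F], the outer endpoint determines the edge. *)
Lemma card_bd_edge_unique F :
  (forall g g' y, g \in F -> g' \in F -> y \notin F ->
     y \in nbrs g -> y \in nbrs g' -> g = g') ->
  #|` bd_edge F| = #|` bd_out F|.
Proof.
move=> un; apply/eqP; rewrite eqn_leq leq_bd_out_edge andbT.
rewrite -(card_inj_fset (bd_out F) (@fset1_inj _)).
apply: (@card_le_inj _ _ _ _ (fun e => e `\` F)).
  move=> e /bd_edgeP [g [h [gF hg hF ->]]]; rewrite (edge_setD gF hF).
  by apply/imfsetP; exists h => //=; apply/bd_outP; split=> //; exists g.
move=> e e' /bd_edgeP [g [h [gF hg hF ->]]] /bd_edgeP [g' [h' [gF' hg' hF' ->]]].
move=> /= eD.
have /fset1_inj e1 := etrans (esym (edge_setD gF hF)) (etrans eD (edge_setD gF' hF')).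
rewrite -e1 in hg' *.
by rewrite (un g g' h gF gF' hF hg hg').
Qed.

Lemma card_ltrans g F : #|` ltrans g F| = #|` F|.
Proof. by apply: card_imfset; exact: wmul_inj. Qed.

Lemma ltransP g F y : reflect (exists2 x, x \in F & y = wmul g x) (y \in ltrans g F).
Proof. exact: imfsetP. Qed.

Lemma bd_out_interior F : bd_out (F `\` bd_in F) `<=` bd_in F.
Proof.
apply/fsubsetP => y /bd_outP [yF0 [g]]; rewrite in_fsetD => /andP[gb gF] yg.
have yF : y \in F.
  by apply: contraNT gb => yF; apply/bd_inP; split=> //; exists y.
by move: yF0; rewrite in_fsetD yF andbT negbK.
Qed.

End WreathGraph.

(** * Lower bounds for the outer boundary *)

Lemma fset_int_max (S : {fset int}) : S != fset0 ->
  exists2 m, m \in S & forall x, x \in S -> (x <= m)%R.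
Proof.
case/fset0Pn => x0 x0S; pose j := [arg max_(i > FSetSub x0S) val i]%O.
exists (val j) => [|x xS]; first exact: valP.
by rewrite /j; case: Order.TotalTheory.arg_maxP => // i _ /(_ (FSetSub xS)); apply.
Qed.

Lemma fset_int_min (S : {fset int}) : S != fset0 ->
  exists2 m, m \in S & forall x, x \in S -> (m <= x)%R.
Proof.
case/fset0Pn => x0 x0S; pose j := [arg min_(i < FSetSub x0S) val i]%O.
exists (val j) => [|x xS]; first exact: valP.
by rewrite /j; case: Order.TotalTheory.arg_minP => // i _ /(_ (FSetSub xS)); apply.
Qed.

Lemma card_bigfcup_le (I T : choiceType) (r : seq I) (G : I -> {fset T}) :
  (#|` \bigcup_(i <- r) G i| <= \sum_(i <- r) #|` G i|)%N.
Proof.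
elim: r => [|i r IH]; first by rewrite !big_nil cardfs0.
rewrite !big_cons (leq_trans _ (leq_add (leqnn _) IH)) //.
by rewrite -cardfsUI leq_addr.
Qed.

Section OuterBoundary.
Variable gT : finGroupType.
Notation cfg := {fsfun int -> gT with 1%g}.
Implicit Types (F : {fset wr gT}) (x y : wr gT).

Definition configs F : {fset cfg} := [fset x.2 | x in F].
Definition levels F : {fset int} := [fset x.1 | x in F].

(** A boundary point with a new configuration is reached only by changing a lamp; the ends of the
    lines through [F] have old configurations. *)
Definition new_out F : {fset wr gT} := [fset y in bd_out F | y.2 \notin configs F].
Definition old_out F : {fset wr gT} := [fset y in bd_out F | y.2 \in configs F].

Lemma configs_neq0 F : F != fset0 -> configs F != fset0.
Proof.
case/fset0Pn => x xF; apply/fset0Pn; exists x.2.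
by apply/imfsetP; exists x.
Qed.

Lemma card_bd_out_split F : (#|` bd_out F| = #|` old_out F| + #|` new_out F|)%N.
Proof.
have <- : bd_out F `&` old_out F = old_out F.
  by apply/fsetP => y; rewrite in_fsetI !in_sep andbA andbb.
have <- : bd_out F `\` old_out F = new_out F.
  by apply/fsetP => y; rewrite in_fsetD !in_sep; case: (_ \in bd_out F); case: (_ \in configs F).
by rewrite cardfsID.
Qed.

Lemma card_old_out F : (2 * #|` configs F| <= #|` old_out F|)%N.
Proof.
(* T1 and T2 collect the boundary points above, respectively below, F on a line. *)
pose T1 := [fset y in old_out F | all (fun x : wr gT => (x.2 == y.2) ==> (x.1 < y.1)%R) F].
pose T2 := [fset y in old_out F | all (fun x : wr gT => (x.2 == y.2) ==> (y.1 < x.1)%R) F].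
(* The configuration of an old point occurs in [F], so its line contains a point that cannot be both
   above and below. *)
have T12 : T1 `&` T2 = fset0.
  apply/fsetP => y; rewrite in_fsetI !in_sep inE; apply/negP.
  case/andP=> /andP[/andP[_ /imfsetP [x /= xF e]] /allP h1] /andP[_ /allP h2].
  have := h1 _ xF; have := h2 _ xF; rewrite e eqxx /=; lia.
have sub : T1 `|` T2 `<=` old_out F.
  by apply/fsubsetP => y; rewrite in_fsetU !in_sep => /orP[] /andP[].
have lineP (f : cfg) k : k \in [fset x.1 | x in [fset x in F | x.2 == f]] -> (k, f) \in F.
  by case/imfsetP => x /=; rewrite in_sep => /andP[xF /eqP <-] ->; case: x xF.
have lineP' x : x \in F -> x.1 \in [fset z.1 | z in [fset z in F | z.2 == x.2]].
  by move=> xF; apply/imfsetP; exists x => //=; rewrite in_sep xF eqxx.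
have c1 : (#|` configs F| <= #|` T1|)%N.
  apply: leq_trans (card_image_le T1 snd).
  apply/fsubset_leq_card/fsubsetP => f /imfsetP [x /= xF ef].
  have /fset_int_max [m mL mM] : [fset z.1 | z in [fset z in F | z.2 == f]] != fset0.
    by apply/fset0Pn; exists x.1; rewrite ef; exact: lineP'.
  have mF := lineP _ _ mL.
  have above z : z \in F -> (z.2 == f) ==> (z.1 < m + 1)%R.
    move=> zF; apply/implyP => /eqP zf; have := lineP' z zF; rewrite zf => /mM; rewrite ltzD1; exact.
  apply/imfsetP; exists ((m + 1)%R, f) => //=; rewrite !in_sep /=.
  apply/andP; split; last by apply/allP => z zF /=; exact: above.
  apply/andP; split; last by apply/imfsetP; exists x.
  apply/bd_outP; split.
    by apply/negP => /above /=; rewrite eqxx ltxx.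
  by exists (m, f) => //; apply/mem_nbrs; left; left.
have c2 : (#|` configs F| <= #|` T2|)%N.
  apply: leq_trans (card_image_le T2 snd).
  apply/fsubset_leq_card/fsubsetP => f /imfsetP [x /= xF ef].
  have /fset_int_min [m mL mM] : [fset z.1 | z in [fset z in F | z.2 == f]] != fset0.
    by apply/fset0Pn; exists x.1; rewrite ef; exact: lineP'.
  have mF := lineP _ _ mL.
  have below z : z \in F -> (z.2 == f) ==> (m - 1 < z.1)%R.
    move=> zF; apply/implyP => /eqP zf; have := lineP' z zF; rewrite zf => /mM; rewrite ltrBlDr ltzD1; exact.
  apply/imfsetP; exists ((m - 1)%R, f) => //=; rewrite !in_sep /=.
  apply/andP; split; last by apply/allP => z zF /=; exact: below.
  apply/andP; split; last by apply/imfsetP; exists x.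
  apply/bd_outP; split.
    by apply/negP => /below /=; rewrite eqxx ltxx.
  by exists (m, f) => //; apply/mem_nbrs; left; right.
have := fsubset_leq_card sub; have := cardfsUI T1 T2; rewrite T12 cardfs0; lia.
Qed.

Lemma not_full_new_out F x : x \in F -> ~~ full (configs F) x.1 x.2 ->
  exists d, [/\ d != x.2 x.1 & (x.1, upd x.2 x.1 d) \in new_out F].
Proof.
move=> xF; have xA : x.2 \in configs F by apply/imfsetP; exists x.
rewrite negb_forall => /existsP [d dA]; exists d.
have dx : d != x.2 x.1 by apply: contraNneq dA => ->; rewrite upd_id.
split=> //; rewrite in_sep dA andbT; apply/bd_outP; split.
  by apply: contra dA => h; apply/imfsetP; exists (x.1, upd x.2 x.1 d).
by exists x => //; apply/mem_nbrs; right; exists d.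
Qed.

Lemma card_le_full_new_out F :
  (#|` F| <= \sum_(k <- levels F) #|` full_at (configs F) k|
             + (#|gT| - 1) * #|` new_out F|)%N.
Proof.
(* [G] collects the points on full cliques at level [k], and [H y] the [q - 1] other points of the
   clique of a new boundary point [y]. *)
pose G k : {fset wr gT} := [fset (k, f) | f in full_at (configs F) k].
pose H y : {fset wr gT} := [fset (y.1, upd y.2 y.1 d) | d in [set~ y.2 y.1]].
have sub : F `<=` (\bigcup_(k <- levels F) G k) `|` \bigcup_(y <- new_out F) H y.
  apply/fsubsetP => x xF; rewrite in_fsetU.
  case: (boolP (full (configs F) x.1 x.2)) => [fx|nfx].
    apply/orP; left; apply/bigfcupP; exists x.1.
      by rewrite andbT; apply/imfsetP; exists x.
    by apply/imfsetP; exists x.2; [exact: (etrans (in_full_at _ _ _)) | case: x xF fx].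
  have [d [dx yN]] := not_full_new_out xF nfx.
  apply/orP; right; apply/bigfcupP; exists (x.1, upd x.2 x.1 d); first by rewrite yN.
  apply/imfsetP; exists (x.2 x.1).
    by rewrite /= !inE updE eqxx eq_sym.
  by rewrite /= upd_upd upd_id; case: x {xF nfx dx yN}.
apply: leq_trans (fsubset_leq_card sub) _.
rewrite (leq_trans (n := #|` \bigcup_(k <- levels F) G k| + #|` \bigcup_(y <- new_out F) H y|)) //.
  by rewrite -cardfsUI leq_addr.
apply: leq_add.
  apply: leq_trans (card_bigfcup_le _ _) _; apply: leq_sum => k _.
  exact: leq_imfset_card.
apply: leq_trans (card_bigfcup_le _ _) _.
rewrite mulnC card_fset_sum1 big_distrl /=; apply: leq_sum => y _; rewrite mul1n.
apply: leq_trans (leq_imfset_card _ _ _) _.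
by rewrite -cardE cardsC1 subn1.
Qed.

Lemma box_zrange (n : nat) (f0 : cfg) (K : {fset int}) : (0 < n)%N -> #|` K| = n ->
  (#|` bd_out (K `*` cube f0 K)| <= 2 * #|gT| ^ n)%N ->
  exists a, K = zrange a n.
Proof.
move=> n0 cK le2; have K0 : K != fset0 by rewrite -cardfs_gt0 cK.
have q0 : (0 < #|gT| ^ n)%N by rewrite expn_gt0; apply/orP; left; apply/card_gt0P; exists 1%g.
have [a aK aM] := fset_int_min K0; have [b bK bM] := fset_int_max K0.
have step c : c \in K -> (c < b)%R -> (c + 1)%R \in K.
  move=> cK' cb; apply: contraLR le2 => c1K; rewrite -ltnNge.
  (* Three levels outside [K] and adjacent to it: each line then carries three boundary points, one
     more than [le2] allows on average. *)
  pose T := [fset (a - 1)%R; (c + 1)%R; (b + 1)%R].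
  have cT : #|` T| = 3%N.
    rewrite /T -fsetUA cardfsU1 cardfs2 !inE; have := aM c cK'; lia.
  apply: (@leq_trans #|` T `*` cube f0 K|).
    by rewrite card_fsetM cT card_cube cK ltn_pmul2r.
  apply/fsubset_leq_card/fsubsetP => -[k f]; rewrite in_fsetM /= => /andP[kT fC].
  have {kT} : [|| k == a - 1, k == c + 1 | k == b + 1]%R.
    by move: kT; rewrite !in_fsetU !in_fset1 -orbA.
  case/or3P=> /eqP ->; apply/bd_outP.
  - split; first by rewrite in_fsetM /=; apply/negP => /andP[/aM]; lia.
    exists (a, f); first by rewrite in_fsetM /= aK.
    by apply/mem_nbrs; left; right.
  - split; first by rewrite in_fsetM /= (negPf c1K).
    exists (c, f); first by rewrite in_fsetM /= cK'.
    by apply/mem_nbrs; left; left.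
  - split; first by rewrite in_fsetM /=; apply/negP => /andP[/bM]; lia.
    exists (b, f); first by rewrite in_fsetM /= bK.
    by apply/mem_nbrs; left; left.
have run i : (a + i%:Z <= b)%R -> (a + i%:Z)%R \in K.
  elim: i => [|i IH] h; first by rewrite addr0.
  rewrite (_ : a + i.+1%:Z = a + i%:Z + 1)%R; last lia.
  apply: step; [apply: IH|]; lia.
have ab := aM b bK.
have EK : K = zrange a (`|b - a|.+1)%N.
  apply/fsetP => x; rewrite in_zrange; apply/idP/idP => [xK|h].
    have := aM x xK; have := bM x xK; lia.
  rewrite (_ : x = a + `|x - a|%N%:Z)%R; last lia.
  apply: run; lia.
by exists a; rewrite {1}EK -cK EK card_zrange.
Qed.

(** With A the configurations, W the full-clique count and D' the number of new boundary points,
    2|F| <= 2W + 2(q - 1)D' <= n(2|A| + D') <= n|bd_out F|. Equality makes every step tight. *)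
Lemma bd_out_small (n : nat) F : (0 < n)%N -> (1 < #|gT|)%N ->
  (2 * (#|gT| - 1) <= n)%N -> F != fset0 -> (#|` configs F| <= #|gT| ^ n)%N ->
  (2 * #|` F| <= n * #|` bd_out F|)%N /\
  ((2 * #|` F| = n * #|` bd_out F|)%N -> (#|` F| <= n * #|gT| ^ n)%N ->
   exists f0 K, #|` K| = n /\ F = K `*` cube f0 K).
Proof.
move=> n0 q1 nq F0 lq.
have A0 := configs_neq0 F0.
have l0 : (0 < #|` configs F|)%N by rewrite cardfs_gt0.
have [iso iso_eq] := full_count_le_psi (fset_uniq (levels F)) q1 A0.
have psin := psi_le q1 l0 lq.
have old := card_old_out F; have split_out := card_bd_out_split F.
have cF := card_le_full_new_out F.
move: iso iso_eq cF; set W := (\sum_(k <- _) _)%N => iso iso_eq cF.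
have Wn : (W <= n * #|` configs F|)%N.
  have : ((#|gT| - 1) * W <= (#|gT| - 1) * (n * #|` configs F|))%N.
    by rewrite -lez_nat; exact: le_trans iso psin.
  by rewrite leq_pmul2l // subn_gt0.
set D' := #|` new_out F| in split_out cF.
have nD : (n * (2 * #|` configs F|) + n * D' <= n * #|` bd_out F|)%N.
  by rewrite -mulnDr leq_mul2l split_out leq_add2r old orbT.
have qD : (2 * (#|gT| - 1) * D' <= n * D')%N by rewrite leq_mul2r nq orbT.
split; first by lia.
move=> E Fn.
have WE : W = (n * #|` configs F|)%N by lia.
have [f0 [K [_ hK]]] : exists f0 (K : {fset int}), {subset K <= levels F} /\
     forall f, f \in configs F <-> agree f0 K f.
  by apply: iso_eq; apply/eqP; rewrite eq_le iso /= WE.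
have AE : configs F = cube f0 K.
  apply/fsetP => f; apply/idP/idP => [/hK/cubeP|/cubeP/hK] //.
have cA : #|` configs F| = (#|gT| ^ #|` K|)%N by rewrite AE card_cube.
(* The bounds [iso] and [psin] coincide, and [psi] is exact at powers of [q], so the exponent is
   [n]. *)
have cK : #|` K| = n.
  have := iso; rewrite WE; have := psin; rewrite cA psi_exp // => h1 h2.
  have /eqP : ((#|gT| - 1) * (#|` K| * #|gT| ^ #|` K|) = (#|gT| - 1) * (n * #|gT| ^ #|` K|))%N.
    by apply/eqP; rewrite eqn_leq -!lez_nat h1 h2.
  rewrite eqn_pmul2l ?subn_gt0 // eqn_pmul2r; first by move/eqP.
  by rewrite expn_gt0; apply/orP; left; lia.
rewrite cK in cA.
have le2 : (#|` bd_out F| <= 2 * #|gT| ^ n)%N.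
  by rewrite -(leq_pmul2l n0) -E; lia.
(* The line ends alone already give [2 * q ^ n] boundary points. *)
have D0 : D' = 0%N by lia.
have cFn : #|` F| = (n * #|gT| ^ n)%N.
  apply/eqP; rewrite eqn_leq Fn /=; rewrite -(@leq_pmul2l 2) // mulnCA -cA E.
  by apply: leq_trans nD; rewrite leq_addr.
exists f0, K; split=> //; apply/eqP; rewrite eqEfcard card_fsetM card_cube cK cFn leqnn andbT.
apply/fsubsetP => x xF; rewrite in_fsetM -AE.
have xA : x.2 \in configs F by apply/imfsetP; exists x.
(* At a level outside [K] the lamp is fixed throughout the cube, so the clique is not full and would
   create a new boundary point. *)
rewrite xA andbT; apply/negPn/negP => xK.
have fx : full (configs F) x.1 x.2.
  apply/negPn/negP => /(not_full_new_out xF) [d [_]].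
  by move/eqP: D0; rewrite cardfs_eq0 => /eqP ->; rewrite inE.
have [d df0] : exists d, d != f0 x.1.
  have : (0 < #|[set~ f0 x.1]|)%N by rewrite cardsC1 -subn1 subn_gt0.
  by case/card_gt0P => d; rewrite !inE => ?; exists d.
have /hK /(_ _ xK) := forallP fx d.
by rewrite updE eqxx => e; rewrite e eqxx in df0.
Qed.

End OuterBoundary.

(** * Sharp inequalities and their extremal sets *)

Section Isoperimetry.
Variables (gT : finGroupType) (n : nat).
Notation cfg := {fsfun int -> gT with 1%g}.
Implicit Types (F : {fset wr gT}) (f : cfg) (a : int).

(** These are the left translates of F_n, which is the case of trivial [f0] and [a = 1]. *)
Definition box f0 a : {fset wr gT} := zrange a n `*` cube f0 (zrange a n).

Lemma card_box f0 a : #|` box f0 a| = (n * #|gT| ^ n)%N.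
Proof. by rewrite card_fsetM card_cube !card_zrange. Qed.

Lemma ltrans_box f0 a : ltrans ((a - 1)%R, f0) (box [fsfun with 1%g] 1%R) = box f0 a.
Proof.
apply/eqP; rewrite eqEfcard card_ltrans !card_box leqnn andbT.
apply/fsubsetP => y /ltransP [[k f]]; rewrite in_fsetM /= in_zrange => /andP[kI /cubeP fC] ->.
rewrite in_fsetM in_zrange; apply/andP; split; first by rewrite /=; lia.
apply/cubeP => x xI; rewrite wmulE /= fC; first by rewrite fsfunE mulg1.
by apply: contra xI; rewrite !in_zrange; lia.
Qed.

(** One inclusion suffices for boxes, where the cardinalities agree. *)
Lemma ltrans_closure (g : wr gT) F :
  ltrans g (F `|` bd_out F) `<=` ltrans g F `|` bd_out (ltrans g F).
Proof.
apply/fsubsetP => y /ltransP [x]; rewrite !in_fsetU => xB ->.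
have gF z : z \in F -> wmul g z \in ltrans g F by move=> zF; apply/ltransP; exists z.
case/orP: xB => [/gF -> //|/bd_outP [_ [z zF xz]]].
case: (boolP (wmul g x \in ltrans g F)) => //= xF; apply/bd_outP; split=> //.
by exists (wmul g z); [exact: gF | exact: nbrs_wmul].
Qed.

Lemma in_FnE F : (forall x, x \in F <-> in_Fn n x) -> F = box [fsfun with 1%g] 1%R.
Proof.
move=> HF; apply/fsetP => -[k f]; rewrite in_fsetM /= in_zrange.
apply/idP/andP => [/HF [/= kI fI]|[kI /cubeP fC]].
  split; first by lia.
  apply/cubeP => x; rewrite in_zrange fsfunE => xI.
  apply: fsfun_dflt; apply/negP => /fI; lia.
apply/HF; split=> /=; first by lia.
move=> y; rewrite mem_finsupp => fy.
have : y \in zrange 1%R n by apply: contraNT fy => /fC ->; rewrite fsfunE.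
rewrite in_zrange; lia.
Qed.

Hypotheses (n_gt0 : (0 < n)%N) (n_large : (2 * (#|gT| - 1) <= n)%N).

Let q_gt0 : (0 < #|gT|)%N.
Proof. by apply/card_gt0P; exists 1%g. Qed.

Let qn_gt0 : (0 < #|gT| ^ n)%N.
Proof. by rewrite expn_gt0 q_gt0. Qed.

Lemma bd_out_configs F : (2 * #|` configs F| <= #|` bd_out F|)%N.
Proof.
by rewrite card_bd_out_split (leq_trans (card_old_out F)) ?leq_addr.
Qed.

(** With at least [q ^ n] configurations the line ends suffice. The minimum allows sets of any size,
    as needed for the interior in [bd_in_ge]. *)
Lemma bd_out_ge F : F != fset0 ->
  (2 * minn #|` F| (n * #|gT| ^ n) <= n * #|` bd_out F|)%N.
Proof.
move=> F0; have D2 := bd_out_configs F.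
have l0 : (0 < #|` configs F|)%N by rewrite cardfs_gt0 configs_neq0.
case: (leqP (#|gT| ^ n) #|` configs F|) => [ql|lq].
  apply: (@leq_trans (2 * (n * #|gT| ^ n))); first by rewrite leq_mul2l geq_minr orbT.
  rewrite mulnCA leq_mul2l (leq_trans _ D2) ?orbT // leq_mul2l ql orbT //.
(* For trivial [gT], [lq] would leave no configuration at all. *)
have q1 : (1 < #|gT|)%N.
  rewrite ltn_neqAle q_gt0 andbT; apply/eqP => q1.
  by move: lq l0; rewrite -q1 exp1n; lia.
have [h _] := bd_out_small n_gt0 q1 n_large F0 (ltnW lq).
by apply: leq_trans h; rewrite leq_mul2l geq_minl orbT.
Qed.

Lemma bd_out_eq F : F != fset0 -> (#|` F| <= n * #|gT| ^ n)%N ->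
  (2 * #|` F| = n * #|` bd_out F|)%N -> exists f0 a, F = box f0 a.
Proof.
move=> F0 Fn E; have D2 := bd_out_configs F.
have le2 : (#|` bd_out F| <= 2 * #|gT| ^ n)%N.
  by rewrite -(leq_pmul2l n_gt0) -E; lia.
have [f0 [K [cK EF]]] : exists f0 K, #|` K| = n /\ F = K `*` cube f0 K.
  (* For trivial D the isoperimetric inequality is void: every clique is full. *)
  case: (ltnP 1 #|gT|) => [q1|q1].
    have [|_ h] := bd_out_small n_gt0 q1 n_large F0 _; last exact: h.
    by rewrite -(@leq_pmul2l 2) // (leq_trans D2).
  have q1' : #|gT| = 1%N by apply/eqP; rewrite eqn_leq q1.
  have gT1 (d e : gT) : d = e by apply: (fintype_le1P q1).
  have cfg1 (f f' : cfg) : f = f' by apply/fsfunP => x; exact: gT1.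
  have [x0 x0F] := fset0Pn _ F0.
  have EF : F = levels F `*` cube x0.2 (levels F).
    apply/fsetP => -[k f]; rewrite in_fsetM /=; apply/idP/andP => [xF|[]].
      split; first by apply/imfsetP; exists (k, f).
      by apply/cubeP => z _; exact: gT1.
    by case/imfsetP => -[k' f'] /= xF -> _; rewrite (cfg1 f f').
  exists x0.2, (levels F); split=> //.
  have cF : #|` F| = #|` levels F|.
    by rewrite {1}EF card_fsetM card_cube q1' exp1n muln1.
  have l0 : (0 < #|` configs F|)%N by rewrite cardfs_gt0 configs_neq0.
  rewrite -cF; move: Fn le2 E; rewrite q1' exp1n muln1 => Fn le2.
  have -> : #|` bd_out F| = 2%N by lia.
  by lia.
have [|a Ka] := @box_zrange gT n f0 K n_gt0 cK; first by rewrite -EF.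
by exists f0, a; rewrite /box -Ka.
Qed.

(** Adding [2 * #|bd_in F|] to the outer inequality for the interior [F'] turns the factor [n] into
    [n + 2]. *)
Lemma bd_in_ge F : F != fset0 -> (#|` F| <= (n + 2) * #|gT| ^ n)%N ->
  (2 * #|` F| <= (n + 2) * #|` bd_in F|)%N /\
  ((2 * #|` F| = (n + 2) * #|` bd_in F|)%N ->
     exists f0 a, F = box f0 a `|` bd_out (box f0 a)).
Proof.
move=> F0 Fn; set F' := F `\` bd_in F.
have sI : bd_in F `<=` F by apply/fsubsetP => x /bd_inP [].
have cF : (#|` F'| + #|` bd_in F| = #|` F|)%N.
  by rewrite cardfsDS // subnK // fsubset_leq_card.
have F_gt0 : (0 < #|` F|)%N by rewrite cardfs_gt0.
case: (eqVneq F' fset0) => [F'0|F'0].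
  move: cF; rewrite F'0 cardfs0 add0n => ->; split; first by rewrite leq_mul2r; lia.
  by move/eqP; rewrite eqn_pmul2r //; lia.
have sub := bd_out_interior F; have /= le_out := fsubset_leq_card sub.
have h := bd_out_ge F'0.
rewrite -/F' in sub le_out.
have le_outn : (n * #|` bd_out F'| <= n * #|` bd_in F|)%N by rewrite leq_mul2l le_out orbT.
have ge2 : (2 * #|` F| <= (n + 2) * #|` bd_in F|)%N.
  case: (leqP #|` F'| (n * #|gT| ^ n)) => F'n.
    by move: h; rewrite (minn_idPl F'n) -cF; lia.
  (* A larger interior still forces [2 * q ^ n] inner boundary points, and the size bound on [F]
     concludes. *)
  move: h; rewrite (minn_idPr (ltnW F'n)) mulnCA => h.
  have : (2 * #|gT| ^ n <= #|` bd_in F|)%N.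
    by rewrite -(leq_pmul2l n_gt0) (leq_trans h).
  rewrite -(leq_pmul2l (_ : 0 < n + 2)%N); last by rewrite addn2.
  lia.
split=> // E.
have I2 : (#|` bd_in F| <= 2 * #|gT| ^ n)%N.
  by rewrite -(@leq_pmul2l (n + 2)%N) ?addn2 // -addn2 -E mulnCA leq_mul2l Fn orbT.
have E' : (2 * #|` F'| = n * #|` bd_in F|)%N.
  by apply: (@addIn (2 * #|` bd_in F|)); rewrite -mulnDr cF E mulnDl.
have F'n : (#|` F'| <= n * #|gT| ^ n)%N.
  have : (n * #|` bd_in F| <= n * (2 * #|gT| ^ n))%N by rewrite leq_mul2l I2 orbT.
  by lia.
rewrite (minn_idPl F'n) E' in h.
have Eout : bd_out F' = bd_in F.
  by apply/eqP; rewrite eqEfcard sub /= -(leq_pmul2l n_gt0).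
have [|f0 [a EF']] := bd_out_eq F'0 F'n; first by rewrite Eout.
exists f0, a; rewrite -EF' Eout /F'.
by apply/fsetP => x; rewrite in_fsetU in_fsetD; case: (boolP (x \in bd_in F)) => [/(fsubsetP sI) ->|_]; rewrite ?orbF.
Qed.

(** A lamp change at a level of the interval stays in the cube, so a box is left only through its
    two end levels. *)
Lemma bd_out_box f0 a : bd_out (box f0 a)
  `<=` [fset (a - 1)%R; (a + n%:Z)%R] `*` cube f0 (zrange a n).
Proof.
apply/fsubsetP => y /bd_outP [yB [[k f]]].
rewrite in_fsetM /= in_zrange => /andP[ka fC] /mem_nbrs [|[d _]] /= e; last first.
  case/negP: yB; rewrite e in_fsetM /= in_zrange ka.
  apply/cubeP => x xI; rewrite updE; case: eqP => [xk|_].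
    by move: xI; rewrite xk in_zrange ka.
  by move/cubeP: fC; apply.
have y2 : y.2 = f by case: e => ->.
rewrite in_fsetM y2 fC andbT !inE.
have : ~~ (a <= y.1 < a + n%:Z)%R.
  by move: yB; rewrite in_fsetM y2 fC andbT in_zrange.
by case: e => -> /=; lia.
Qed.

(** The lower bound is the isoperimetric inequality applied to the box itself. *)
Lemma card_bd_out_box f0 a : #|` bd_out (box f0 a)| = (2 * #|gT| ^ n)%N.
Proof.
apply/eqP; rewrite eqn_leq; apply/andP; split.
  apply: leq_trans (fsubset_leq_card (bd_out_box f0 a)) _.
  by rewrite card_fsetM card_cube card_zrange leq_mul2r cardfs2 ltnS leq_b1 orbT.
have B0 : box f0 a != fset0 by rewrite -cardfs_gt0 card_box muln_gt0 n_gt0.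
have := bd_out_ge B0; rewrite card_box minnn mulnCA.
by rewrite leq_pmul2l.
Qed.

Lemma card_bd_edge_box f0 a : #|` bd_edge (box f0 a)| = #|` bd_out (box f0 a)|.
Proof.
apply: card_bd_edge_unique => g g' y gB gB' yB yg yg'.
have yO : y \in bd_out (box f0 a) by apply/bd_outP; split=> //; exists g.
have := fsubsetP (bd_out_box f0 a) _ yO.
have tline h : h \in box f0 a -> y \in nbrs h ->
    y = ((h.1 + 1)%R, h.2) \/ y = ((h.1 - 1)%R, h.2).
  move=> hB /mem_nbrs [//|[d _ e]]; case/negP: yB.
  move: hB; rewrite e !in_fsetM /= => /andP[h1 h2]; rewrite h1.
  apply/cubeP => x xI; rewrite updE; case: eqP => [xh|_].
    by rewrite xh h1 in xI.
  by move/cubeP: h2; apply.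
move: (tline g gB yg) (tline g' gB' yg') (gB) (gB').
case: g g' y {gB gB' yB yg yg' tline yO} => [k f] [k' f'] [l h].
rewrite !in_fsetM /= !in_zrange !inE => e e' /andP[kI _] /andP[kI' _] /andP[lI _].
have fE : f = f' by case: e => -[_ <-]; case: e' => -[_ <-].
rewrite fE; congr (_, _).
by case: e => -[e _]; case: e' => -[e' _]; move: lI; rewrite ?e; lia.
Qed.

Lemma card_box_closure f0 a :
  #|` box f0 a `|` bd_out (box f0 a)| = ((n + 2) * #|gT| ^ n)%N.
Proof.
rewrite cardfsU (_ : _ `&` _ = fset0) ?cardfs0 ?subn0.
  by rewrite card_box card_bd_out_box mulnDl.
by apply/fsetP => x; rewrite in_fsetI inE; apply/negP => /andP[xB /bd_outP []]; rewrite xB.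
Qed.

(** Points of the box have all their neighbours in the closure, which gives the upper bound;
    [bd_in_ge] gives the lower one. *)
Lemma card_bd_in_box f0 a :
  #|` bd_in (box f0 a `|` bd_out (box f0 a))| = (2 * #|gT| ^ n)%N.
Proof.
set B := box f0 a; apply/eqP; rewrite eqn_leq; apply/andP; split.
  rewrite -(card_bd_out_box f0 a); apply/fsubset_leq_card/fsubsetP => x.
  case/bd_inP; rewrite in_fsetU => /orP[xB|//] [h hx].
  rewrite in_fsetU negb_or => /andP[hB]; case/negP.
  by apply/bd_outP; split=> //; exists x.
have c := card_box_closure f0 a.
have C0 : B `|` bd_out B != fset0 by rewrite -cardfs_gt0 c muln_gt0 addn2.
have [|h _] := bd_in_ge C0; first by rewrite c.
by move: h; rewrite c mulnCA leq_pmul2l // addn2.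
Qed.

Lemma ltrans_box_closure f0 a :
  ltrans ((a - 1)%R, f0)
    (box [fsfun with 1%g] 1%R `|` bd_out (box [fsfun with 1%g] 1%R))
  = box f0 a `|` bd_out (box f0 a).
Proof.
apply/eqP; rewrite eqEfcard card_ltrans !card_box_closure leqnn andbT.
by rewrite -(ltrans_box f0 a); exact: ltrans_closure.
Qed.

End Isoperimetry.

(** * Passage to ratios and the final statement *)

Lemma qratio_le a b c d : (0 < b)%N -> (0 < d)%N ->
  (qratio a b <= qratio c d)%R = (a * d <= c * b)%N.
Proof.
move=> b0 d0; rewrite /qratio ler_pdivrMr ?ltr0n // mulrAC ler_pdivlMr ?ltr0n //.
by rewrite -!natrM ler_nat.
Qed.

Lemma qratio_lt a b c d : (0 < b)%N -> (0 < d)%N ->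
  (qratio a b < qratio c d)%R = (a * d < c * b)%N.
Proof. by move=> b0 d0; rewrite !ltNge qratio_le // -ltnNge. Qed.

Lemma qratio_eq a b c d : (0 < b)%N -> (0 < d)%N ->
  qratio a b = qratio c d -> (a * d = c * b)%N.
Proof.
move=> b0 d0 E; by apply/eqP; rewrite eqn_leq -!qratio_le // E lexx.
Qed.

Theorem mainTheorem2 (gT : finGroupType) (n : nat)
  (Hn1 : (1 <= n)%N) (HnD : (2 * (#|gT| - 1) <= n)%N)
  (Fn : {fset wr gT}) (HFn : forall x : wr gT, x \in Fn <-> in_Fn n x) :
  let Bn := Fn `|` bd_out Fn in
  (* (1) *)
  (forall F : {fset wr gT}, F != fset0 -> (#|` F| <= #|` Fn|)%N ->
     [/\ (qratio (#|` bd_out F|) (#|` F|) <= qratio (#|` bd_edge F|) (#|` F|))%R,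
         (qratio (#|` bd_out Fn|) (#|` Fn|) <= qratio (#|` bd_out F|) (#|` F|))%R,
         qratio (#|` bd_out Fn|) (#|` Fn|) = qratio (#|` bd_edge Fn|) (#|` Fn|),
         ((#|` F| < #|` Fn|)%N ->
            (qratio (#|` bd_out Fn|) (#|` Fn|) < qratio (#|` bd_out F|) (#|` F|))%R) &
         (qratio (#|` bd_out F|) (#|` F|) = qratio (#|` bd_out Fn|) (#|` Fn|) ->
            exists g : wr gT, F = ltrans g Fn)]) /\
  (* (2) *)
  (forall F : {fset wr gT}, F != fset0 -> (#|` F| <= #|` Bn|)%N ->
     [/\ (qratio (#|` bd_in Bn|) (#|` Bn|) <= qratio (#|` bd_in F|) (#|` F|))%R,
         ((#|` F| < #|` Bn|)%N ->
            (qratio (#|` bd_in Bn|) (#|` Bn|) < qratio (#|` bd_in F|) (#|` F|))%R) &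
         (qratio (#|` bd_in F|) (#|` F|) = qratio (#|` bd_in Bn|) (#|` Bn|) ->
            exists g : wr gT, F = ltrans g Bn)]).
Proof.
rewrite (in_FnE HFn) => Bn {HFn Fn}; set Fn := box n _ _ in Bn *.
have q0 : (0 < #|gT| ^ n)%N.
  by rewrite expn_gt0; apply/orP; left; apply/card_gt0P; exists 1%g.
have cFn : #|` Fn| = (n * #|gT| ^ n)%N by exact: card_box.
have cDn : #|` bd_out Fn| = (2 * #|gT| ^ n)%N by exact: card_bd_out_box.
have cBn : #|` Bn| = ((n + 2) * #|gT| ^ n)%N by exact: card_box_closure.
have cIn : #|` bd_in Bn| = (2 * #|gT| ^ n)%N by exact: card_bd_in_box.
have Fn0 : (0 < #|` Fn|)%N by rewrite cFn muln_gt0 Hn1.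
have Bn0 : (0 < #|` Bn|)%N by rewrite cBn muln_gt0 addn2.
split=> F F0 leF; have F_gt0 : (0 < #|` F|)%N by rewrite cardfs_gt0.
- have ge2 : (2 * #|` F| <= n * #|` bd_out F|)%N.
    by have := bd_out_ge Hn1 HnD F0; rewrite -cFn (minn_idPl leF).
  have eqF : (2 * #|` F| = n * #|` bd_out F|)%N -> exists g, F = ltrans g Fn.
    rewrite cFn in leF; move/(bd_out_eq Hn1 HnD F0 leF) => [f0 [a ->]].
    by exists ((a - 1)%R, f0); rewrite ltrans_box.
  split.
  + by rewrite qratio_le // leq_mul2r leq_bd_out_edge orbT.
  + rewrite qratio_le // cDn cFn mulnAC mulnA [(_ * n)%N]mulnC.
    by rewrite leq_pmul2r.
  + by rewrite card_bd_edge_box.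
  (* Strictness comes from uniqueness: equality would make [F] a translate, hence of full
     cardinality. *)
  + move=> ltF; rewrite qratio_lt // cDn cFn mulnAC mulnA [(_ * n)%N]mulnC.
    rewrite ltn_pmul2r // ltn_neqAle ge2 andbT; apply/eqP => /eqF [g E].
    by rewrite E card_ltrans ltnn in ltF.
  + move/(qratio_eq F_gt0 Fn0); rewrite cDn cFn [(2 * _ * _)%N]mulnAC mulnA [(_ * n)%N]mulnC.
    by move/eqP; rewrite eqn_pmul2r // => /eqP /esym.
- rewrite cBn in leF; have [ge2 eqF'] := bd_in_ge Hn1 HnD F0 leF.
  have eqF : (2 * #|` F| = (n + 2) * #|` bd_in F|)%N -> exists g, F = ltrans g Bn.
    move/eqF' => [f0 [a ->]].
    by exists ((a - 1)%R, f0); rewrite ltrans_box_closure.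
  split.
  + rewrite qratio_le // cIn cBn mulnAC mulnA [(_ * (n + 2))%N]mulnC.
    by rewrite leq_pmul2r.
  + move=> ltF; rewrite qratio_lt // cIn cBn mulnAC mulnA [(_ * (n + 2))%N]mulnC.
    rewrite ltn_pmul2r // ltn_neqAle ge2 andbT; apply/eqP => /eqF [g E].
    by rewrite E card_ltrans ltnn in ltF.
  + move/(qratio_eq F_gt0 Bn0); rewrite cIn cBn [(2 * _ * _)%N]mulnAC mulnA [(_ * (n + 2))%N]mulnC.
    by move/eqP; rewrite eqn_pmul2r // => /eqP /esym.
Qed.
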